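(* Let $G=H\oplus_3 K$ be a proper $3$-sum of $2$-connected cubic graphs $H$ and $K$ with distinguished vertices $u\in V(H)$ and $v\in V(K)$, where $\pi(H)\ge 5$, $K$ is $3$-edge-colourable, and $u$ is an apex of $H$. If $\pi(G)\ge 5$, then $K$ is quasi-bipartite and has a bipartising set $U$ such that $\{v\}$ is a component of $K-U$ (i.e. $v$ forms a trivial component of the quasi-partite set of $K$).
   Context: Graphs are finite; loops and multiple edges are allowed. The perfect matching index $\pi(G)$ of a bridgeless cubic graph is the smallest number of perfect matchings whose union is $E(G)$. A $3$-sum $H\oplus_3 K$ with distinguished vertices $u,v$ deletes $u$ and $v$ and joins the three dangling edge-ends formerly at $u$ bijectively to the three formerly at $v$; it is proper if neither $H$ nor $K$ is the $3$-dipole (two vertices joined by three parallel edges) and neither $u$ nor $v$ is incident with a pair of parallel edges. For a vertex $w$ of a $2$-connected cubic graph $X$ with no $3$-edge-colouring, $X^w$ denotes the graph obtained by inflating $w$ to a triangle (deleting $w$, adding a triangle on new vertices, attaching the three edge-ends formerly at $w$ to its three distinct vertices), and $w$ is an apex of $X$ if $\pi(X^w)=4$. A $2$-connected cubic graph $K$ is quasi-bipartite if it has an independent vertex set $U$ with $|U|\ge 2$ such that contracting each component of $K-U$ to a vertex yields a bipartite cubic graph (possibly with multiple edges) with partite sets $U$ and the set of contracted vertices; $U$ is a bipartising set and the components of $K-U$ form the quasi-partite set. *)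

(* Defs.v *)
(* Cubic multigraphs (loops and multiple edges allowed)
   encoded by darts (half-edges). *)
From HB Require Import structures.
From mathcomp Require Import all_boot all_order.
Set Implicit Arguments. Unset Strict Implicit. Unset Printing Implicit Defensive.

(* A graph: finite set of darts, an involution [ginv] pairing the two darts of
   each edge (a loop is an edge whose two darts are at the same vertex), and
   the vertex [node d] at which dart d sits.  The vertex set of the graph is
   the image of [node] (elements of [vtx] carrying no dart are not vertices). *)
Record cgraph := CGraph {
  dart : finType;
  vtx : finType;
  ginv : dart -> dart;
  node : dart -> vtx }.
Arguments ginv : clear implicits.
Arguments node : clear implicits.

Section Basic.
Variable G : cgraph.

Definition vertices : {set vtx G} := [set node G d | d : dart G].
Definition darts_at (x : vtx G) : {set dart G} := [set d | node G d == x].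

Definition cubic : Prop :=
  [/\ forall d, ginv G (ginv G d) = d,
      forall d, ginv G d != d &
      forall d, #|darts_at (node G d)| = 3].

Definition adj : rel (vtx G) :=
  fun x y => [exists d, (node G d == x) && (node G (ginv G d) == y)].
Definition connected : Prop := {in vertices &, forall x y, connect adj x y}.
Definition adj_del (e : dart G) : rel (vtx G) :=
  fun x y => [exists d, [&& d != e, d != ginv G e, node G d == x
                            & node G (ginv G d) == y]].
Definition bridgeless : Prop :=
  forall e, {in vertices &, forall x y, connect (adj_del e) x y}.

(* 2-connected cubic graph (for cubic graphs: connected and bridgeless) *)
Definition two_connected_cubic : Prop := [/\ cubic, connected & bridgeless].

(* perfect matching: an edge set (ginv-closed dart set) meeting every vertex
   in exactly one dart (hence containing no loop) *)
Definition perfect_matching (M : {set dart G}) : bool :=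
  [forall d, (d \in M) == (ginv G d \in M)] &&
  [forall d, #|M :&: darts_at (node G d)| == 1].

Definition pm_coverable (k : nat) : bool :=
  [exists f : {ffun 'I_k -> {set dart G}},
     [forall i, perfect_matching (f i)] && [forall d, [exists i, d \in f i]]].

(* perfect matching index: least k such that E(G) is a union of k perfect
   matchings (every bridgeless cubic graph has one <= #|darts|). *)
Definition pmi : nat := find pm_coverable (iota 0 #|dart G|.+1).

Definition colourable3 : Prop :=
  exists c : dart G -> 'I_3,
    (forall d, c (ginv G d) = c d) /\
    (forall d d', d != d' -> node G d = node G d' -> c d != c d').

(* the 3-dipole: two vertices joined by three parallel edges *)
Definition is_dipole : Prop :=
  [/\ cubic, #|vertices| = 2 & forall d, node G (ginv G d) != node G d].

Definition parallel_at (x : vtx G) : Prop :=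
  exists d d', [/\ node G d = x, node G d' = x, d != d', d' != ginv G d
                 & node G (ginv G d) = node G (ginv G d')].
End Basic.

(* Inflation X^w of a vertex w to a triangle: the triangle vertices are
   indexed by the three darts at w; the triangle darts are ordered pairs of
   distinct darts at w. *)
Section Inflate.
Variables (X : cgraph) (w : vtx X).
Local Notation Dw := {d : dart X | node X d == w}.
Local Notation TD := {p : Dw * Dw | p.1 != p.2}.

Lemma tri_swap_proof (p : TD) : (val p).2 != (val p).1.
Proof. by case: p => [[a b] /= h]; rewrite eq_sym. Qed.

Definition tri_swap (p : TD) : TD := exist _ ((val p).2, (val p).1) (tri_swap_proof p).

Definition infl_inv (d : (dart X + TD)%type) : (dart X + TD)%type :=
  match d with inl d => inl (ginv X d) | inr p => inr (tri_swap p) end.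

Definition infl_node (d : (dart X + TD)%type) : (vtx X + Dw)%type :=
  match d with
  | inl d => if (insub d : option Dw) is Some dw then inr dw else inl (node X d)
  | inr p => inr (val p).1
  end.

Definition inflate : cgraph :=
  @CGraph (dart X + TD)%type (vtx X + Dw)%type infl_inv infl_node.
End Inflate.

Definition apex (X : cgraph) (w : vtx X) : Prop :=
  [/\ two_connected_cubic X, ~ colourable3 X, w \in vertices X
    & pmi (inflate w) = 4].

(* 3-sum H (+)_3 K at u, v; phi is the bijection from the darts at u to the
   darts at v (the edge a-d of H with d at u and the edge e-b of K with
   e = phi d at v become the single edge a-b). *)
Section Sum3.
Variables (H K : cgraph) (u : vtx H) (v : vtx K)
          (phi : {d : dart H | node H d == u} -> {e : dart K | node K e == v}).
Local Notation DH := {a : dart H | node H a != u}.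
Local Notation DK := {b : dart K | node K b != v}.
Local Notation Du := {d : dart H | node H d == u}.

Definition sum_inv (x : (DH + DK)%type) : (DH + DK)%type :=
  match x with
  | inl a =>
      let a' := ginv H (val a) in
      if (insub a' : option DH) is Some a2 then inl a2 else
      if (insub a' : option Du) is Some du then
        (if (insub (ginv K (val (phi du))) : option DK) is Some b then inr b else x)
      else x
  | inr b =>
      let b' := ginv K (val b) in
      if (insub b' : option DK) is Some b2 then inr b2 else
      if [pick du : Du | val (phi du) == b'] is Some du then
        (if (insub (ginv H (val du)) : option DH) is Some a then inl a else x)
      else x
  end.

Definition sum_node (x : (DH + DK)%type) : (vtx H + vtx K)%type :=
  match x with inl a => inl (node H (val a)) | inr b => inr (node K (val b)) end.

Definition sum3 : cgraph := @CGraph (DH + DK)%type (vtx H + vtx K)%type sum_inv sum_node.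
End Sum3.

Definition proper_3sum (H K : cgraph) (u : vtx H) (v : vtx K) : Prop :=
  [/\ ~ is_dipole H, ~ is_dipole K, ~ parallel_at u & ~ parallel_at v].

Section QB.
Variables (K : cgraph) (U : {set vtx K}).

Definition adj_out : rel (vtx K) :=
  fun x y => [&& x \notin U, y \notin U & adj x y].

Definition contract (x : vtx K) : vtx K := if x \in U then x else root adj_out x.

Local Notation CD := {d : dart K | (node K d \in U) || (node K (ginv K d) \in U)}.
Definition contr_inv (d : CD) : CD := odflt d (insub (ginv K (val d))).
Definition contr_node (d : CD) : vtx K := contract (node K (val d)).
Definition contracted : cgraph := @CGraph CD (vtx K) contr_inv contr_node.

Definition bipartising_set : Prop :=
  [/\ U \subset vertices K,
      forall d, node K d \in U -> node K (ginv K d) \notin U,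
      2 <= #|U|,
      cubic contracted &
      forall d : dart contracted,
        (node contracted d \in U) != (node contracted (ginv contracted d) \in U)].
End QB.

Definition quasi_bipartite (K : cgraph) : Prop := exists U : {set vtx K}, bipartising_set U.

(* Main.v *)
Require Import Defs.
From mathcomp Require Import all_boot.
Set Implicit Arguments. Unset Strict Implicit. Unset Printing Implicit Defensive.

(* Among four perfect matchings covering H^u, each contains either all three
   edges leaving the triangle or exactly one, and each leaving edge is the only
   one used by some matching. Suppose K has an edge set N containing the three
   edges at v and exactly one edge at every other vertex. Gluing each matching
   of the first kind to N, and each of the second kind to the colour class of K
   that agrees with it on the cut, covers G with four perfect matchings.
   Hence if pi(G) >= 5 there is no such N, that is, K - v - N(v) has no perfect
   matching. The Tutte-Berge formula (and parity) gives a set S whose removal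
   leaves at least |S| + 2 odd components. Put U = S + N(v): the graph K - U has
   at least |U| odd components, {v} among them. Each sends at least three edges
   to U, as K is bridgeless and cubic, while U receives at most 3|U| edges.
   So all these bounds are equalities and U is a bipartising set. *)

(** * The Tutte-Berge formula *)

(** The points moved by an involution fall into pairs; the induction removes one pair at a time. *)
Lemma odd_card_fix (T : finType) (f : T -> T) (A : {set T}) :
  involutive f -> (forall x, x \in A -> f x \in A) ->
  odd #|A| = odd #|[set x in A | f x == x]|.
Proof.
move=> fK; move: {2}#|A|.+1 (ltnSn #|A|) => n.
elim: n A => // n IHn A leAn fA.
case: (pickP [pred x in A | f x != x]) => [x /andP [/= xA fxx] | noA]; last first.
  congr odd; apply: eq_card => x; rewrite inE.
  by move: (noA x) => /=; case: (x \in A) => //= /negbFE ->.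
set B := A :\ x :\ f x.
have fxB : f x \in A :\ x by rewrite !inE fxx fA.
have cA : #|A| = #|B|.+2 by rewrite (cardsD1 x) xA (cardsD1 (f x) (A :\ x)) fxB.
have fB y : y \in B -> f y \in B.
  rewrite !inE => /and3P [yfx yx yA]; rewrite fA // andbT.
  by rewrite (can_eq fK) yx /= -(can_eq fK) fK.
rewrite cA /= negbK IHn //; last by rewrite -ltnS; apply: leq_ltn_trans leAn; rewrite cA.
congr odd; apply: eq_card => y; rewrite !inE.
case: (y =P x) => [->|_]; first by rewrite (negPf fxx) !andbF.
by case: (y =P f x) => [->|_] //=; rewrite fK eq_sym (negPf fxx) andbF.
Qed.

Section TutteBerge.
Variables (T : finType) (e : rel T).
Hypothesis e_sym : symmetric e.
Implicit Types (W S X P : {set T}) (M N : {ffun T -> T}).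

Definition restr X : rel T := fun x y => [&& x \in X, y \in X & e x y].

(** An odd component is represented by its canonical root. Points outside [X] are isolated for
    [restr X] and would count as odd components, so membership in [X] is required. *)
Definition odd_roots X : {set T} :=
  [set r in X | (root (restr X) r == r) && odd #|[set y | connect (restr X) r y]|].

(* A matching inside W is encoded as the involution exchanging matched vertices
   and fixing the other ones. *)
Definition is_matching W M : bool :=
  [forall x, (M (M x) == x) && ((M x == x) || restr W x (M x))].

Definition unmatched W M : {set T} := [set x in W | M x == x].

Definition maximum W M : Prop :=
  is_matching W M /\
  forall N, is_matching W N -> #|unmatched W M| <= #|unmatched W N|.

Lemma restr_sym X : symmetric (restr X).
Proof. by move=> x y; rewrite /restr e_sym; case: (x \in X); rewrite ?andbF. Qed.


Lemma restr_csym X : connect_sym (restr X).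
Proof. exact: sym_connect_sym (restr_sym X). Qed.

Lemma is_matchingP W M :
  reflect (involutive M /\ forall x, M x = x \/ restr W x (M x)) (is_matching W M).
Proof.
apply: (iffP forallP) => [h | [MK hM] x].
  by split=> x; have /andP [/eqP eq1 /orP [/eqP|]] := h x; [ | | left | right].
by rewrite MK eqxx; case: (hM x) => [->|->]; rewrite ?eqxx ?orbT.
Qed.

Lemma odd_unmatched W M : is_matching W M -> odd #|unmatched W M| = odd #|W|.
Proof.
move=> /is_matchingP [MK hM]; rewrite [RHS](@odd_card_fix _ M) // => x xW.
by case: (hM x) => [->|/and3P []].
Qed.

Lemma maximum_exists W : exists M, maximum W M.
Proof.
have id0 : is_matching W [ffun x => x].
  by apply/is_matchingP; split=> [x|x]; rewrite !ffunE; [|left].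
case: (@arg_minnP _ [ffun x => x] (is_matching W) (fun M => #|unmatched W M|) id0).
by move=> M MW Mmin; exists M.
Qed.

(** Otherwise matching [x] with [y] would leave fewer vertices unmatched. *)
Lemma unmatched_adj W M x y :
  maximum W M -> x \in unmatched W M -> y \in unmatched W M -> e x y -> x = y.
Proof.
case=> /is_matchingP [MK hM] Mmin; rewrite !inE => /andP [xW /eqP Mx] /andP [yW /eqP My] exy.
apply/eqP; apply: contraT => xy.
pose N := [ffun t => if t == x then y else if t == y then x else M t].
have Nx : N x = y by rewrite ffunE eqxx.
have Ny : N y = x by rewrite ffunE eqxx eq_sym (negPf xy).
have Nt t : t != x -> t != y -> N t = M t by rewrite ffunE => /negPf -> /negPf ->.
have MW : is_matching W N.
  apply/is_matchingP; split=> t.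
    have [->|tx] := eqVneq t x; first by rewrite Nx Ny.
    have [->|ty] := eqVneq t y; first by rewrite Ny Nx.
    by rewrite Nt // Nt ?MK // -(can_eq MK) MK ?Mx ?My.
  have [->|tx] := eqVneq t x; first by right; rewrite Nx /restr xW yW.
  have [->|ty] := eqVneq t y; first by right; rewrite Ny /restr xW yW e_sym.
  by rewrite Nt.
have: #|unmatched W N| < #|unmatched W M|.
  apply: proper_card; apply/properP; split.
    apply/subsetP=> t; rewrite !inE => /andP [-> /=].
    have [->|tx] := eqVneq t x; first by rewrite Mx.
    have [->|ty] := eqVneq t y; first by rewrite My.
    by rewrite Nt.
  by exists x; rewrite !inE xW ?Mx //= Nx eq_sym.
by rewrite ltnNge Mmin.
Qed.

Lemma switch_matching W M N P :
  is_matching W M -> is_matching W N ->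
  (forall x, x \in P -> M x \in P) -> (forall x, x \in P -> N x \in P) ->
  is_matching W [ffun x => if x \in P then N x else M x].
Proof.
move=> /is_matchingP [MK hM] /is_matchingP [NK hN] MP NP.
apply/is_matchingP; split=> x; rewrite !ffunE; case: (boolP (x \in P)) => xP //.
  by rewrite NP.
by case: ifP => [/MP|]; rewrite MK // (negPf xP).
Qed.

Lemma card_unmatched_switch W M N P :
  #|unmatched W [ffun x => if x \in P then N x else M x]| =
  #|unmatched W N :&: P| + #|unmatched W M :\: P|.
Proof.
rewrite -(cardsID P (unmatched W _)); congr (_ + _);
  by apply: eq_card => x; rewrite !inE ffunE; case: (x \in P); rewrite ?andbF.
Qed.

(** Exchanging [M] and [N] on [P] keeps the total number of unmatched vertices of the two. As [N] is
    maximum, the switched [N] misses at least as many vertices as [N], so the switched [M] misses at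
    most as many as [M]. *)
Lemma switch_maximum W M N P :
  maximum W M -> maximum W N ->
  (forall x, x \in P -> M x \in P) -> (forall x, x \in P -> N x \in P) ->
  maximum W [ffun x => if x \in P then N x else M x].
Proof.
move=> [MW Mmin] [NW Nmin] MP NP; split; first exact: switch_matching.
move=> L LW; apply: leq_trans (Mmin L LW).
have := Nmin _ (switch_matching NW MW NP MP).
rewrite !card_unmatched_switch -(cardsID P (unmatched W N)) -(cardsID P (unmatched W M)).
by rewrite leq_add2r leq_add2r.
Qed.

(* The alternating path of M and N from y is the orbit of y under N \o M; as the
   other end of this path is unique, it avoids x or z. *)
Lemma maximum_exchange W M N x y z :
  maximum W M -> maximum W N -> x \in unmatched W M -> z \in unmatched W M ->
  x != z -> y \in unmatched W N ->
  exists2 L, maximum W L &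
    (y \in unmatched W L) && ((x \in unmatched W L) || (z \in unmatched W L)).
Proof.
move=> Mmax Nmax xM zM xz yN.
have [/is_matchingP [MK _] _] := Mmax; have [/is_matchingP [NK _] _] := Nmax.
have [[xW Mx] [zW Mz] [yW Ny]] :
  [/\ x \in W /\ M x = x, z \in W /\ M z = z & y \in W /\ N y = y].
  by move: xM zM yN; rewrite !inE => /andP [? /eqP ?] /andP [? /eqP ?] /andP [? /eqP ?].
pose q t := N (M t).
have qI : injective q by apply: inj_comp; apply: can_inj; [exact: NK | exact: MK].
(* Conjugation by [M] inverts [q], and [N y = y] makes [M y] the predecessor of [y]. Hence the orbit
   of [y] is closed under [M], and then under [N]. *)
have qM i t : iter i q (M (iter i q t)) = M t.
  by elim: i t => //= i IHi t; rewrite -iterS iterSr /q MK NK IHi.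
have qMy i : iter i.+1 q (M (iter i q y)) = y by rewrite iterS qM /q MK.
pose P := [set t | fconnect q y t].
have PE t : t \in P -> exists i, t = iter i q y.
  by rewrite inE => /iter_findex <-; exists (findex q y t).
have MP t : t \in P -> M t \in P.
  move=> /PE [i ->]; rewrite inE fconnect_sym //.
  by rewrite -{2}(qMy i) fconnect_iter.
have NP t : t \in P -> N t \in P.
  move=> /PE [[|i] ->]; first by rewrite Ny inE connect0.
  by rewrite iterS /q NK; apply: MP; rewrite inE fconnect_iter.
exists [ffun t => if t \in P then N t else M t]; first exact: switch_maximum.
rewrite !inE !ffunE yW xW zW inE connect0 Ny eqxx /=.
suff: (x \notin P) || (z \notin P).
  by case/orP=> /negPf ->; rewrite ?Mx ?Mz eqxx ?orbT.
rewrite -negb_and; apply: contra xz => /andP [/PE [i xi] /PE [j zj]].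
wlog le_ij : x z xM zM xW zW Mx Mz i j xi zj / i <= j.
  move=> wl; case: (leqP i j) => [le_ij|/ltnW le_ij]; first exact: (wl x z _ _ _ _ _ _ i j).
  by rewrite eq_sym; exact: (wl z x _ _ _ _ _ _ j i).
have zx : z = iter (j - i) q x by rewrite xi -iterD subnK.
(* Since [M] fixes both [x] and [z], the point [x] returns after 2d steps of [q]; since [N] fixes
   [y], it returns after 2i+1 steps. As d(2i+1) = d + i(2d), it returns after d steps already, so
   [z = x]. *)
set d := j - i in zx.
have qdd : iter d q (iter d q x) = x by rewrite -zx -{1}Mz zx qM Mx.
have qii : iter (i + i.+1) q x = x.
  by rewrite iterD -{1}Mx {1}xi qMy -xi.
have per a b t : iter a q t = t -> iter (b * a) q t = t.
  by move=> ha; elim: b => // b IHb; rewrite mulSn iterD IHb.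
have h1 : iter (i * (d + d)) q x = x by apply: per; rewrite iterD qdd.
have h2 : iter (d * (i + i.+1)) q x = x by apply: per.
have dE : d * (i + i.+1) = d + i * (d + d).
  by rewrite addnS mulnS mulnDr mulnDr ![d * i]mulnC.
by rewrite zx -{1}h2 dE iterD h1.
Qed.

(** Induction on the path. If [y] follows [x] on it, some maximum matching misses [y], and
    [maximum_exchange] yields one missing [y] together with [x] or [z]. In the first case adjacency
    forces [x = y]; in the second the shorter path from [y] to [z] gives [y = z]. *)
Lemma connect_unmatched W M x z :
  (forall y, y \in W -> exists2 N, maximum W N & y \in unmatched W N) ->
  maximum W M -> x \in unmatched W M -> z \in unmatched W M ->
  connect (restr W) x z -> x = z.
Proof.
move=> allW Mmax xM zM /connectP [p].
elim: p x M Mmax xM zM => [|y p IHp] x M Mmax xM zM /=; first by move=> _ ->.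
case/andP=> /and3P [xW yW exy] py zE; apply/eqP; apply: contraT => xz.
have [N Nmax yN] := allW _ yW.
have [L Lmax /andP [yL]] := maximum_exchange Mmax Nmax xM zM xz yN.
have adjM : x != y -> y \notin unmatched W M.
  by apply: contra => yM; apply/eqP; apply: (unmatched_adj Mmax).
have [yz|yz] := eqVneq y z; first by move: adjM; rewrite yz zM => /(_ xz).
case/orP=> [xL | zL]; last by rewrite (IHp y L) ?eqxx in yz.
have xy := unmatched_adj Lmax xL yL exy.
by move: yz; rewrite (IHp y M) ?eqxx // -xy.
Qed.

(** By [connect_unmatched] a component has at most one unmatched vertex. A component with one is
    odd, because it is the only fixed point of [M] there. *)
Lemma unmatched_le_odd_roots W M :
  maximum W M ->
  (forall y, y \in W -> exists2 N, maximum W N & y \in unmatched W N) ->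
  #|unmatched W M| <= #|odd_roots W|.
Proof.
move=> Mmax allW; have [/is_matchingP [MK hM] _] := Mmax.
have cs := restr_csym W.
have rI : {in unmatched W M &, injective (root (restr W))}.
  by move=> x z xM zM /(rootP cs); apply: (connect_unmatched allW Mmax).
rewrite -(card_in_imset rI); apply: subset_leq_card.
apply/subsetP=> _ /imsetP [x xM ->].
have inW t : connect (restr W) x t -> t \in W.
  case/connectP=> p pp ->; elim/last_ind: p pp => [|p t' _] /=.
    by move: xM; rewrite inE => /andP [].
  by rewrite rcons_path last_rcons => /andP [_ /and3P []].
rewrite inE inW ?connect_root //= root_root //= eqxx /=.
rewrite (@odd_card_fix _ M) //; last first.
  move=> t; rewrite !inE => /connect_trans; apply.
  by case: (hM t) => [->|/connect1].
rewrite (_ : [set _ in _ | _] = [set x]) ?cards1 //.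
apply/setP=> t; rewrite !inE -(same_connect cs (connect_root _ x)).
apply/andP/eqP => [[xt /eqP Mt]|->]; last by move: xM; rewrite inE connect0 => /andP [].
by symmetry; apply: (connect_unmatched allW Mmax) => //; rewrite inE Mt inW ?eqxx.
Qed.

(* Gallai's argument: if some y in W is covered by every maximum matching, put y
   in S and induct; otherwise S can be taken empty. *)
Theorem tutte_berge W :
  exists M S, [/\ is_matching W M, S \subset W &
    #|unmatched W M| + #|S| <= #|odd_roots (W :\: S)|].
Proof.
move: {2}#|W|.+1 (ltnSn #|W|) => n; elim: n W => // n IHn W leWn.
have [M Mmax] := maximum_exists W.
case: (boolP [forall y in W, [exists N,
   (is_matching W N) && (#|unmatched W N| == #|unmatched W M|) && (y \in unmatched W N)]]).
  move/forall_inP=> allW; exists M, set0; rewrite sub0set cards0 addn0 setD0.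
  split=> //; first by case: Mmax.
  apply: unmatched_le_odd_roots => // y /allW /existsP [N /andP [/andP [NW /eqP cN] yN]].
  by exists N => //; split=> // L; rewrite cN; case: Mmax => _ h /h.
rewrite negb_forall_in => /exists_inP [y yW /existsPn noN].
have [|N [S [NW SW NS]]] := IHn (W :\ y).
  by move: leWn; rewrite (cardsD1 y W) yW.
have [/is_matchingP [NK hN]] := (NW).
have NW' : is_matching W N.
  apply/is_matchingP; split=> // x; case: (hN x) => [|h]; [by left | right].
  by move: h; rewrite /restr !inE => /and3P [/andP [_ ->] /andP [_ ->] ->].
have Ny : N y = y by case: (hN y) => //; rewrite /restr !inE eqxx.
have uE : unmatched (W :\ y) N = unmatched W N :\ y.
  by apply/setP=> x; rewrite !inE andbA.
have yN : y \in unmatched W N by rewrite inE yW Ny eqxx.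
have cN : #|unmatched W N| = #|unmatched (W :\ y) N|.+1.
  by rewrite (cardsD1 y) yN uE.
have [MW Mmin] := Mmax.
have lt1 : #|unmatched W M| < #|unmatched W N|.
  by rewrite ltn_neqAle Mmin // andbT eq_sym; move: (noN N); rewrite NW' yN andbT.
(* Both counts have the parity of [#|W|], so [N] misses at least two vertices more than [M]. One of
   the two is [y]; the other pays for putting [y] into the barrier. *)
have lt2 : #|unmatched W M| < #|unmatched (W :\ y) N|.
  move: lt1; rewrite cN ltnS leq_eqVlt => /orP [/eqP eqc|//].
  by have := odd_unmatched MW; rewrite -(odd_unmatched NW') cN eqc /=; case: odd.
exists M, (y |: S); split=> //.
  by apply/subsetP=> x; rewrite !inE => /orP [/eqP -> // | /(subsetP SW)]; rewrite inE => /andP [].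
have yS : y \notin S by apply/negP=> /(subsetP SW); rewrite !inE eqxx.
rewrite cardsU1 yS addnA addn1 -setDDl.
by apply: leq_trans NS; rewrite leq_add2r.
Qed.

End TutteBerge.

(** * Gluing matchings across a 3-sum *)

Lemma pmi_le_of_coverable (G : cgraph) k : pm_coverable G k -> pmi G <= k.
Proof.
move=> Gk; rewrite leqNgt; apply/negP=> lt_k.
have k_size : k < (#|dart G|).+1.
  apply: leq_trans lt_k _.
  by have := find_size (pm_coverable G) (iota 0 (#|dart G|).+1); rewrite size_iota.
by have := before_find 0 lt_k; rewrite nth_iota // add0n Gk.
Qed.

(** When no number in the list works, [find] returns its length [#|dart G|.+1]; the bound excludes
    this default value. *)
Lemma coverable_pmi (G : cgraph) : pmi G <= #|dart G| -> pm_coverable G (pmi G).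
Proof.
move=> le_pmi; have : has (pm_coverable G) (iota 0 (#|dart G|).+1).
  by rewrite has_find size_iota.
by move/(nth_find 0); rewrite nth_iota.
Qed.

Lemma card3_third (T : finType) (A : {set T}) b c :
  #|A| = 3 -> b \in A -> c \in A -> b != c ->
  exists a, [/\ a \in A, a != b, a != c & forall x, x \in A -> [|| x == a, x == b | x == c]].
Proof.
move=> A3 bA cA bc.
have : #|A :\ b :\ c| == 1.
  have := cardsD1 b A; rewrite bA A3.
  by rewrite (cardsD1 c (A :\ b)) !inE eq_sym bc cA !add1n => -[<-].
case/cards1P=> a aE; have : a \in A :\ b :\ c by rewrite aE inE.
rewrite !inE => /and3P [ac ab aA]; exists a; split=> // x xA.
have : (x \in A :\ b :\ c) = (x == a) by rewrite aE inE.
by rewrite !inE xA => <-; case: (x == b); case: (x == c).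
Qed.

Definition meets_once (G : cgraph) (M : {set dart G}) (x : vtx G) : Prop :=
  exists d, [/\ d \in M, node G d = x & forall d', d' \in M -> node G d' = x -> d' = d].

Lemma meets_onceP (G : cgraph) (M : {set dart G}) (x : vtx G) :
  reflect (meets_once M x) (#|M :&: darts_at x| == 1).
Proof.
apply: (iffP cards1P) => [[d dE] | [d [dM dx dU]]]; exists d.
  have : d \in M :&: darts_at x by rewrite dE inE.
  rewrite !inE => /andP [dM /eqP dx]; split=> // d' d'M d'x; apply/set1P.
  by rewrite -dE !inE d'M d'x eqxx.
apply/setP=> d'; rewrite !inE; apply/andP/eqP => [[d'M /eqP d'x]|->]; first exact: dU.
by rewrite dx.
Qed.

Lemma perfect_matchingP (G : cgraph) (M : {set dart G}) :
  reflect ((forall d, (ginv G d \in M) = (d \in M)) /\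
           forall d, meets_once M (node G d)) (perfect_matching M).
Proof.
apply: (iffP andP) => -[h1 h2]; split.
- by move=> d; rewrite (eqP (forallP h1 d)).
- by move=> d; apply/meets_onceP/(forallP h2).
- by apply/forallP=> d; rewrite h1.
- by apply/forallP=> d; apply/meets_onceP.
Qed.

(** * Edge cuts in bridgeless cubic graphs *)

Section CubicGraph.
Variable G : cgraph.
Hypothesis Gcubic : cubic G.
Implicit Types (C : {set vtx G}) (d : dart G).

(** Each crossing edge contributes only its dart inside [C], so the cardinality is the size of the
    edge cut. *)
Definition cut C : {set dart G} :=
  [set d | (node G d \in C) && (node G (ginv G d) \notin C)].

Lemma ginvK d : ginv G (ginv G d) = d.
Proof. by case: Gcubic. Qed.

Lemma ginv_neq d : ginv G d != d.
Proof. by case: Gcubic. Qed.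

Lemma node_vertex d : node G d \in vertices G.
Proof. exact: imset_f. Qed.

Lemma card_darts_at x : x \in vertices G -> #|darts_at x| = 3.
Proof. by case/imsetP=> d _ ->; case: Gcubic. Qed.

Lemma adj_sym : symmetric (@adj G).
Proof.
have sub x y : adj x y -> @adj G y x.
  case/existsP=> d /andP [dx dy]; apply/existsP; exists (ginv G d).
  by rewrite ginvK dx dy.
by move=> x y; apply/idP/idP; apply: sub.
Qed.

Lemma card_darts_in C :
  C \subset vertices G -> #|[set d | node G d \in C]| = 3 * #|C|.
Proof.
move=> CV; rewrite -sum1_card (partition_big (node G) (mem C)) /=; last first.
  by move=> d; rewrite inE.
rewrite mulnC -sum_nat_const; apply: eq_bigr => x xC.
rewrite -(card_darts_at (subsetP CV _ xC)) -sum1_card; apply: eq_bigl => d.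
by rewrite !inE; case: eqP => [->|]; rewrite ?xC ?andbF.
Qed.

(** Among the [3 * #|C|] darts at [C], those outside the cut are paired by [ginv]. *)
Lemma odd_cut C : C \subset vertices G -> odd #|cut C| = odd #|C|.
Proof.
move=> CV; have cE := cardsID (cut C) [set d | node G d \in C].
rewrite card_darts_in // in cE.
have : odd (3 * #|C|) = odd #|C| by rewrite oddM.
rewrite -cE oddD (_ : _ :&: _ = cut C); last first.
  by apply/setP=> d; rewrite !inE; case: (_ \in C).
rewrite (odd_card_fix (A := _ :\: _) ginvK) => [|d]; last first.
  rewrite !inE ginvK negb_and negbK => /andP [/orP [/negPf -> // | h1] h2].
  by rewrite h1 h2.
rewrite (_ : [set _ in _ | _] = set0) ?cards0 ?addbF //.
by apply/setP=> d; rewrite !inE (negPf (ginv_neq d)) andbF.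
Qed.

Hypothesis Gbridgeless : bridgeless G.

(** The size is odd by [odd_cut], so only 1 must be excluded. If the cut were a single dart, a path
    joining its ends without its edge would have to leave [C] by another dart. *)
Lemma cut_ge3 C : C \subset vertices G -> odd #|C| -> 3 <= #|cut C|.
Proof.
move=> CV Codd; have := odd_cut CV; rewrite Codd.
have : #|cut C| != 1.
  apply/negP=> /cards1P [d cutd].
  have : d \in cut C by rewrite cutd inE.
  rewrite inE => /andP [dC dnC].
  have := Gbridgeless d (node_vertex d) (node_vertex (ginv G d)).
  case/connectP=> p; elim: p (node G d) dC => [|y p IHp] x xC /=.
    by move=> _ xE; rewrite xE xC in dnC.
  case/andP=> /existsP [d' /and4P [d'd _ /eqP d'x /eqP d'y]]; apply: IHp.
  apply: contraT => yC; suff : d' \in cut C by rewrite cutd inE (negPf d'd).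
  by rewrite inE d'x d'y xC.
by case: #|cut C| => [|[|[|n]]].
Qed.

(** The cut around a single vertex has at least three darts, hence contains all the darts at that
    vertex. *)
Lemma no_loop d : node G (ginv G d) != node G d.
Proof.
have sub : cut [set node G d] \subset darts_at (node G d).
  by apply/subsetP=> d'; rewrite !inE => /andP [].
have := cut_ge3 (C := [set node G d]).
rewrite sub1set node_vertex cards1 => /(_ isT isT) ge3.
have : d \in darts_at (node G d) by rewrite inE.
have /eqP <- : cut [set node G d] == darts_at (node G d).
  by rewrite eqEcard sub (card_darts_at (node_vertex d)).
by rewrite !inE eqxx.
Qed.

Lemma ginv_away x d : node G d == x -> node G (ginv G d) != x.
Proof. by move/eqP <-; exact: no_loop. Qed.

End CubicGraph.

(** * Perfect matchings of a graph with an inflated vertex *)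

Section Inflated.
Variables (H : cgraph) (u : vtx H).
Hypotheses (Hcubic : cubic H) (uV : u \in vertices H).
Local Notation Du := {d : dart H | node H d == u}.

(** The triangle is contracted back to [u]. The result need not be a perfect matching of [H], as it
    may contain all three darts at [u]. *)
Definition uninflate (M : {set dart (inflate u)}) : {set dart H} :=
  [set d | (inl d : dart (inflate u)) \in M].

Variable M : {set dart (inflate u)}.
Hypothesis Mpm : perfect_matching M.

Lemma infl_node_at (d : Du) : node (inflate u) (inl (val d)) = inr d.
Proof. by rewrite /= valK. Qed.

Lemma infl_node_away d : node H d != u -> node (inflate u) (inl d) = inl (node H d).
Proof. by move=> du; rewrite /= insubN. Qed.

Lemma uninflate_ginv d : (ginv H d \in uninflate M) = (d \in uninflate M).
Proof. by have /perfect_matchingP [Mc _] := Mpm; rewrite !inE -[RHS]Mc. Qed.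

Lemma uninflate_meets d : node H d != u -> meets_once (uninflate M) (node H d).
Proof.
move=> du; have /perfect_matchingP [_ /(_ (inl d))] := Mpm.
rewrite infl_node_away // => -[[d'|p] [d'M d'x dU]] //.
have d'u : node H d' != u.
  by apply/negP=> h; move: d'x; rewrite /= (insubT (fun d => node H d == u) h).
exists d'; move: d'x; rewrite infl_node_away // => -[d'x]; split=> //; first by rewrite inE.
move=> d2; rewrite inE => d2M d2x; suff [] : (inl d2 : dart (inflate u)) = inl d' by [].
by apply: dU => //; rewrite infl_node_away d2x.
Qed.

Lemma Du_other (a : Du) : exists x : Du, x != a.
Proof.
have : 0 < #|darts_at u :\ val a|.
  have := cardsD1 (val a) (darts_at u); rewrite (card_darts_at Hcubic uV) inE (valP a) add1n.
  by case=> <-.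
case/card_gt0P=> x; rewrite !inE => /andP [xa xu].
by exists (exist _ x xu); rewrite -(inj_eq val_inj).
Qed.

Lemma Du_third (b c : Du) : b != c ->
  exists a : Du, [/\ a != b, a != c & forall x : Du, [|| x == a, x == b | x == c]].
Proof.
move=> bc; have card3 := card_darts_at Hcubic uV.
have [|||a [au ab ac aU]] := card3_third (b := val b) (c := val c) card3.
- by rewrite inE (valP b).
- by rewrite inE (valP c).
- by rewrite (inj_eq val_inj).
have au' : node H a == u by rewrite inE in au.
exists (Sub a au'); split=> [||x]; rewrite -!(inj_eq val_inj) //.
by apply: aU; rewrite inE (valP x).
Qed.

(** The two corners joined by [p] are covered by it, so their outer darts are not in [M]. A triangle
    edge at the third corner would meet one of these two again, so that corner is covered by its
    outer dart. *)
Lemma uninflate_triangle (p : {p : Du * Du | p.1 != p.2}) (x : Du) :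
  (inr p : dart (inflate u)) \in M ->
  (val x \in uninflate M) = (x != (val p).1) && (x != (val p).2).
Proof.
have /perfect_matchingP [Mc Mo] := Mpm.
have tri_uniq (d d' : dart (inflate u)) :
    d \in M -> d' \in M -> node _ d = node _ d' -> d = d'.
  by move=> dM d'M dd'; have [d0 [_ _ d0U]] := Mo d; rewrite (d0U d) // (d0U d').
have away (q : {p : Du * Du | p.1 != p.2}) :
    (inr q : dart (inflate u)) \in M -> val (val q).1 \notin uninflate M.
  move=> qM; rewrite inE; apply/negP=> dM.
  by have := tri_uniq _ _ dM qM (infl_node_at _).
have swapM (q : {p : Du * Du | p.1 != p.2}) :
    (inr q : dart (inflate u)) \in M -> (inr (tri_swap q) : dart (inflate u)) \in M.
  by rewrite -[inr (tri_swap q)]/(ginv (inflate u) (inr q)) Mc.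
move=> pM; have pM' := swapM _ pM.
have [->|xb] := eqVneq x (val p).1; first by rewrite (negPf (away _ pM)).
have [->|xc] /= := eqVneq x (val p).2; first by have /negPf := away _ pM'.
have [a [_ _ aU]] := Du_third (valP p).
have xa : x = a by have := aU x; rewrite (negPf xb) (negPf xc) !orbF => /eqP.
have [[d|q] [dM dx _]] := Mo (inl (val x)); rewrite infl_node_at in dx.
  suff <- : d = val x by rewrite inE.
  by move: dx => /=; case: insubP => // d0 _ <- [->].
case: dx => qx; have qM' := swapM _ dM.
have := aU (val q).2; rewrite -xa -qx eq_sym (negPf (valP q)) /= => /orP [] /eqP q2.
  have /(congr1 (fun d => if d is inr r then (val r).2 else x)) /= E :=
    tri_uniq _ _ qM' pM (congr1 inr q2).
  by rewrite -E qx eqxx in xc.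
have /(congr1 (fun d => if d is inr r then (val r).2 else x)) /= E :=
  tri_uniq _ _ qM' pM' (congr1 inr q2).
by rewrite -E qx eqxx in xb.
Qed.

(** If the outer dart at some corner is missing, a triangle edge covers that corner, and
    [uninflate_triangle] leaves only the third corner. *)
Lemma uninflate_single_or_all :
  (forall x : Du, val x \in uninflate M) \/
  exists a : Du, forall x : Du, (val x \in uninflate M) = (x == a).
Proof.
case: (boolP [forall x : Du, val x \in uninflate M]) => [/forallP|]; first by left.
rewrite negb_forall => /existsP [b bN]; right.
have /perfect_matchingP [_ Mo] := Mpm.
have [[d|p] [dM dx _]] := Mo (inl (val b)); rewrite infl_node_at in dx.
  have bd : d = val b by move: dx => /=; case: insubP => // d0 _ <- [->].
  by move: bN; rewrite inE -bd dM.
have [a [ab ac aU]] := Du_third (valP p).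
exists a => x; rewrite (uninflate_triangle _ dM); have := aU x.
have [->|xa] /= := eqVneq x a; first by rewrite ab ac.
by case/orP=> ->; rewrite ?andbF.
Qed.

End Inflated.

(** In a loopless graph this is a spanning subgraph made of a claw centred at [v] and disjoint
    single edges. *)
Definition claw_factor (K : cgraph) (v : vtx K) (N : {set dart K}) : Prop :=
  [/\ forall d, (ginv K d \in N) = (d \in N),
      forall d, node K d = v -> d \in N &
      forall d, node K d != v -> meets_once N (node K d)].

Section Gluing.
Variables (H K : cgraph) (u : vtx H) (v : vtx K).
Variable phi : {d : dart H | node H d == u} -> {e : dart K | node K e == v}.
Local Notation Du := {d : dart H | node H d == u}.
Hypotheses (phi_bij : bijective phi) (Htc : two_connected_cubic H) (Ktc : two_connected_cubic K).
Hypotheses (uV : u \in vertices H) (vV : v \in vertices K).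

Definition glue (A : {set dart H}) (B : {set dart K}) : {set dart (sum3 phi)} :=
  [set x : dart (sum3 phi) | match x with inl a => val a \in A | inr b => val b \in B end].

Lemma glue_perfect_matching (A : {set dart H}) (B : {set dart K}) :
  (forall d, (ginv H d \in A) = (d \in A)) ->
  (forall d, (ginv K d \in B) = (d \in B)) ->
  (forall d, node H d != u -> meets_once A (node H d)) ->
  (forall d, node K d != v -> meets_once B (node K d)) ->
  (forall d : Du, (val d \in A) = (val (phi d) \in B)) ->
  perfect_matching (glue A B).
Proof.
move=> Ac Bc Ao Bo AB; have [Hc _ Hb] := Htc; have [Kc _ Kb] := Ktc.
have [psi phiK psiK] := phi_bij.
apply/perfect_matchingP; split=> -[a|b].
- rewrite !inE /=; case: insubP => [a2 _ a2E | ]; first by rewrite a2E Ac.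
  rewrite negbK => au; rewrite insubT /=.
  set du := (X in phi X).
  (* As [K] has no loop, the other end of this edge survives the deletion of [v], so the fallback
     branch of [sum_inv] is not reached. The same holds for [H] below. *)
  have bv : node K (ginv K (val (phi du))) != v.
    by apply: (ginv_away Kc Kb); apply: valP (phi du).
  by rewrite insubT /= Bc -AB /= Ac.
- rewrite !inE /=; case: insubP => [b2 _ b2E | ]; first by rewrite b2E Bc.
  rewrite negbK => bv.
  case: pickP => [du /eqP duE | /(_ (psi (exist _ (ginv K (val b)) bv)))]; last first.
    by rewrite psiK eqxx.
  have ndu : node H (ginv H (val du)) != u by apply: (ginv_away Hc Hb); apply: valP du.
  by rewrite insubT /= Ac AB /= duE Bc.
- have [d [dA dx dU]] := Ao _ (valP a).
  have du : node H d != u by rewrite dx (valP a).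
  exists (inl (Sub d du)); rewrite inE /= dx; split=> // -[a'|b'] //.
  by rewrite inE => a'A [a'x]; congr inl; apply: val_inj; apply: dU.
- have [d [dB dx dU]] := Bo _ (valP b).
  have dv : node K d != v by rewrite dx (valP b).
  exists (inr (Sub d dv)); rewrite inE /= dx; split=> // -[a'|b'] //.
  by rewrite inE => b'B [b'x]; congr inr; apply: val_inj; apply: dU.
Qed.

Lemma sum3_coverable (N : {set dart K}) :
  claw_factor v N -> colourable3 K -> pm_coverable (inflate u) 4 ->
  pm_coverable (sum3 phi) 4.
Proof.
move=> [Nc Nv No] [c [cc cI]] /existsP [M /andP [/forallP Mpm /forallP Mcov]].
have [Hc _ _] := Htc; have [Kc _ _] := Ktc.
have colour_at x i : x \in vertices K -> exists2 d, node K d = x & c d = i.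
  move=> xV; have cinj : {in darts_at x &, injective c}.
    move=> d d'; rewrite !inE => /eqP dx /eqP d'x cdd'; apply/eqP; apply: contraT => dd'.
    by have := cI _ _ dd' (etrans dx (esym d'x)); rewrite cdd' eqxx.
  have /eqP cT : c @: darts_at x == setT.
    by rewrite eqEcard subsetT cardsT card_ord card_in_imset // card_darts_at.
  have : i \in c @: darts_at x by rewrite cT inE.
  by case/imsetP=> d; rewrite inE => /eqP dx ->; exists d.
have [psi phiK psiK] := phi_bij.
pose A i := uninflate (M i).
(* When [A i] has a single dart at [u], the second branch is one colour class of [K], as [single]
   shows. *)
pose B i := if [forall x : Du, val x \in A i] then N
            else [set b | [exists x : Du, (val x \in A i) && (c b == c (val (phi x)))]].
have phi_colour (x y : Du) : c (val (phi x)) = c (val (phi y)) -> x = y.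
  move=> cxy; apply: (bij_inj phi_bij); apply: val_inj; apply/eqP; apply: contraT => xy.
  have at_v d : node K (val (phi d)) = v by apply/eqP; apply: valP (phi d).
  by have := cI _ _ xy (etrans (at_v x) (esym (at_v y))); rewrite cxy eqxx.
have single i (a : Du) : (forall x : Du, (val x \in A i) = (x == a)) ->
    B i = [set b | c b == c (val (phi a))].
  move=> aE; have [x xa] := Du_other Hc uV a.
  rewrite /B; case: ifP => [/forallP /(_ x)|_]; first by rewrite aE (negPf xa).
  apply/setP=> b; rewrite !inE; apply/existsP/idP => [[y]|cb].
    by rewrite aE => /andP [/eqP ->].
  by exists a; rewrite aE eqxx.
have all_or_single i := uninflate_single_or_all Hc uV (Mpm i).
apply/existsP; exists [ffun i => glue (A i) (B i)]; apply/andP; split; apply/forallP.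
  move=> i; rewrite ffunE; apply: glue_perfect_matching.
  - by move=> d; apply: uninflate_ginv.
  - move=> d; rewrite /B; case: ifP => _; first exact: Nc.
    by rewrite !inE; apply: eq_existsb => x; rewrite cc.
  - by move=> d; apply: uninflate_meets.
  - move=> d dv; case: (all_or_single i) => [allA | [a aE]].
      by rewrite /B (introT forallP allA); apply: No.
    rewrite (single i a aE).
    have [d0 d0x d0c] := colour_at (node K d) (c (val (phi a))) (node_vertex d).
    exists d0; split=> [||d']; rewrite ?inE ?d0c // => /eqP d'c d'x.
    apply/eqP; apply: contraT => d'd0.
    by have := cI _ _ d'd0 (etrans d'x (esym d0x)); rewrite d'c d0c eqxx.
  - move=> x; case: (all_or_single i) => [allA | [a aE]].
      rewrite allA /B (introT forallP allA) Nv //; apply/eqP; apply: valP (phi x).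
    rewrite (single i a aE) aE inE; apply/eqP/eqP => [-> //|]; exact: phi_colour.
case=> [a|b].
  have /existsP [i iM] := Mcov (inl (val a)).
  by apply/existsP; exists i; rewrite ffunE !inE.
(* To cover [b], take the dart [e] at [v] with the colour of [b] and the corner [a] corresponding to
   it. A matching containing the triangle edge opposite to [a] leaves the triangle only at [a], so
   it is glued to the colour class of [b]. *)
have [e ev ec] := colour_at v (c (val b)) vV.
have ev' : node K e == v by apply/eqP.
pose a := psi (exist _ e ev').
have [x xa] := Du_other Hc uV a.
have [y [yx ya yU]] := Du_third Hc uV xa.
have xy : (x, y).1 != (x, y).2 by rewrite eq_sym.
have /existsP [i iM] := Mcov (inr (Sub (x, y) xy)).
apply/existsP; exists i; rewrite ffunE inE (single i a) ?inE.
  by rewrite psiK /= ec.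
move=> z; rewrite (uninflate_triangle Hc uV (Mpm i) _ iM) /=.
have := yU z; have [->|za] := eqVneq z a; first by rewrite ![a == _]eq_sym xa ya.
by rewrite orbF => /orP [] ->; rewrite ?andbF.
Qed.

End Gluing.

(** * Odd components of K - U *)

Section Barrier.
Variables (K : cgraph) (U : {set vtx K}).
Hypotheses (Kcubic : cubic K) (Kbridgeless : bridgeless K).
Hypothesis UV : U \subset vertices K.

(** Formulated with [adj_out U], so that the representatives are the vertices to which [contract U]
    sends the components. *)
Definition odd_components : {set vtx K} :=
  [set r in vertices K :\: U | (root (adj_out U) r == r) &&
     odd #|[set y | connect (adj_out U) r y]|].

Local Notation comp r := [set y | connect (adj_out U) r y].

Lemma adj_out_sym : symmetric (adj_out U).
Proof. by move=> x y; rewrite /adj_out (adj_sym Kcubic); case: (x \in U); rewrite ?andbF. Qed.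

Lemma adj_out_csym : connect_sym (adj_out U).
Proof. exact: sym_connect_sym adj_out_sym. Qed.

Lemma connect_out x y : connect (adj_out U) x y -> x \notin U -> y \notin U.
Proof.
case/connectP=> p pp -> xU; elim/last_ind: p pp => [|p z _] //.
by rewrite rcons_path last_rcons => /andP [_ /and3P []].
Qed.

Lemma comp_vertices r : r \in vertices K -> comp r \subset vertices K.
Proof.
move=> rV; apply/subsetP=> y; rewrite inE => /connectP [p pp ->].
elim/last_ind: p pp => [|p z _] //.
rewrite rcons_path last_rcons => /andP [_ /and3P [_ _ /existsP [d /andP [_ /eqP <-]]]].
exact: node_vertex.
Qed.

Lemma cut_comp r d : r \notin U ->
  (d \in cut (comp r)) = connect (adj_out U) r (node K d) && (node K (ginv K d) \in U).
Proof.
move=> rU; rewrite !inE; apply: andb_id2l => rd; apply/idP/idP; last first.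
  by move=> dU; apply/negP=> /connect_out /(_ rU); rewrite dU.
have dO := connect_out rd rU; apply: contraR => dU.
apply: connect_trans rd _; apply: connect1.
by rewrite /adj_out dO dU; apply/existsP; exists d; rewrite !eqxx.
Qed.

(* Each odd component sends at least 3 darts to U and each vertex of U receives
   at most 3, so both bounds are attained everywhere. *)
Lemma barrier_tight : #|U| <= #|odd_components| ->
  (forall d, node K d \in U ->
     node K (ginv K d) \notin U /\ root (adj_out U) (node K (ginv K d)) \in odd_components) /\
  (forall r, r \in odd_components -> #|cut (comp r)| = 3).
Proof.
move=> leU; have cs := adj_out_csym.
(* The edges between odd components and [U] are counted twice: by component through the cuts, and
   through [ginv] among the darts at [U]. *)
pose E := [set d | [&& node K d \notin U, node K (ginv K d) \in U &
                     root (adj_out U) (node K d) \in odd_components]].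
have ginvI : injective (ginv K) by apply: can_inj (ginvK Kcubic).
have EF : ginv K @: E \subset [set d | node K d \in U].
  by apply/subsetP=> _ /imsetP [d dE ->]; move: dE; rewrite !inE => /and3P [].
have leE : #|E| <= 3 * #|U|.
  by rewrite -(card_darts_in Kcubic UV) -(card_imset _ ginvI) subset_leq_card.
have cardE : #|E| = \sum_(r in odd_components) #|cut (comp r)|.
  rewrite -sum1_card.
  rewrite (partition_big (fun d => root (adj_out U) (node K d)) (mem odd_components)) /=; last first.
    by move=> d; rewrite inE => /and3P [].
  apply: eq_bigr => r rO; rewrite -sum1_card; apply: eq_bigl => d.
  move: (rO); rewrite [in X in X -> _]inE => /andP [/setDP [_ rU] /andP [/eqP rr _]].
  rewrite cut_comp // -(root_connect cs) rr inE [_ == r]eq_sym.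
  case: (r =P _) => [dr|_]; last by rewrite andbF.
  rewrite -dr rO !andbT /= andb_idl // => _; apply: connect_out rU.
  by apply/(rootP cs); rewrite rr.
have ge3 r : r \in odd_components -> 3 <= #|cut (comp r)| ?= iff (#|cut (comp r)| == 3).
  rewrite inE => /andP [/setDP [rV rU] /andP [_ ro]].
  split; last by rewrite eq_sym.
  by apply: cut_ge3 => //; apply: comp_vertices.
have /leqif_sum := ge3; rewrite sum_nat_const -cardE => -[le3 eq3].
have leOU : 3 * #|U| <= #|odd_components| * 3 by rewrite mulnC leq_mul2r.
(* The chain 3|U| <= 3|odd components| <= |E| <= 3|U| collapses. Its last equality makes every dart
   at [U] lead to an odd component; the middle one, through [leqif_sum], makes every cut have size
   3. *)
have Eeq : #|E| = 3 * #|U|.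
  by apply/eqP; rewrite eqn_leq leE (leq_trans leOU le3).
have /eqP FE : ginv K @: E == [set d | node K d \in U].
  by rewrite eqEcard EF (card_imset _ ginvI) (card_darts_in Kcubic UV) Eeq leqnn.
split=> [d dU | r rO].
  have : d \in ginv K @: E by rewrite FE inE.
  by case/imsetP=> d' d'E ->; move: d'E; rewrite (ginvK Kcubic) [in X in X -> _]inE => /and3P [].
have : #|odd_components| * 3 == #|E|.
  by rewrite eqn_leq le3 Eeq leOU.
by rewrite eq3 => /forall_inP /(_ r rO) /eqP.
Qed.

Lemma barrier_bipartising :
  1 < #|U| -> #|U| <= #|odd_components| -> bipartising_set U.
Proof.
move=> U2 leU; have [out tight] := barrier_tight leU; have cs := adj_out_csym.
have contract_in x : (contract U x \in U) = (x \in U).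
  rewrite /contract; case: ifP => [->|/negbT xU] //; apply/negbTE.
  exact: connect_out (connect_root _ _) xU.
have indep d : node K d \in U -> node K (ginv K d) \notin U by case/out.
have invE (d : dart (contracted U)) : val (ginv (contracted U) d) = ginv K (val d).
  rewrite /= /contr_inv insubT /= => [|?]; last by [].
  by rewrite (ginvK Kcubic) orbC (valP d).
split=> //; last first.
  move=> d; rewrite /= /contr_node !contract_in invE.
  have := valP d => /=; case: (boolP (node K (val d) \in U)) => [dU _|_ /= -> //].
  by rewrite (negPf (indep _ dU)).
have sub_card (A : {set dart K}) (B : {set dart (contracted U)}) :
    val @: B = A -> #|B| = #|A| by move=> <-; rewrite card_imset //; apply: val_inj.
split=> d.
- by apply: val_inj; rewrite !invE (ginvK Kcubic).
- by rewrite -(inj_eq val_inj) invE (ginv_neq Kcubic).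
have memval (A : {set dart K}) :
   (forall d, d \in A -> (node K d \in U) || (node K (ginv K d) \in U)) ->
   (forall e : dart (contracted U), (e \in darts_at (node (contracted U) d)) = (val e \in A)) ->
   #|darts_at (node (contracted U) d)| = #|A|.
  move=> AC h; apply: sub_card; apply/setP=> e; apply/imsetP/idP=> [[e' e'd ->]|eA].
    by rewrite -h.
  by exists (Sub e (AC _ eA)); rewrite ?h SubK.
(* A vertex of [U] keeps its three darts, all of which survive; a contracted component keeps exactly
   the darts of its cut, three by tightness. *)
have [dU|dU] := boolP (node K (val d) \in U).
  rewrite (memval (darts_at (node K (val d)))) ?(card_darts_at Kcubic) ?node_vertex //.
    by move=> e; rewrite inE => /eqP ->; rewrite dU.
  move=> e; rewrite !inE /= /contr_node {2}/contract dU.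
  apply/eqP/eqP => [eE|->]; last by rewrite /contract dU.
  have : contract U (node K (val e)) \in U by rewrite eE.
  by rewrite contract_in => eU; move: eE; rewrite /contract eU.
have d'U : node K (ginv K (val d)) \in U by have := valP d; rewrite /= (negPf dU).
have [_] := out _ d'U; rewrite (ginvK Kcubic); set r := root _ _ => rO.
have rU : r \notin U by apply: connect_out (connect_root _ _) dU.
have rE : root (adj_out U) r = r by apply: root_root.
rewrite (memval (cut (comp r))); first exact: tight.
  by move=> e; rewrite cut_comp // => /andP [_ ->]; rewrite orbT.
move=> e; rewrite cut_comp // inE /= /contr_node {2}/contract (negPf dU) -/r.
rewrite -(root_connect cs) rE /contract; have := valP e => /=.
case: ifP => [eU _ | _ /= ->]; last by rewrite andbT eq_sym.
rewrite (negPf (indep _ eU)) andbF; apply/negP=> /eqP er.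
by rewrite -er eU in rU.
Qed.

End Barrier.

(** * A claw factor at v or a bipartising set *)

Section Claw.
Variables (K : cgraph) (v : vtx K).
Hypotheses (Kcubic : cubic K) (Kbridgeless : bridgeless K).
Hypotheses (vV : v \in vertices K) (v_simple : ~ parallel_at v).

Definition neighbours : {set vtx K} := [set node K (ginv K d) | d in darts_at v].

(** Two spokes with the same end are parallel edges unless they are the two darts of a loop, which
    [no_loop] excludes. *)
Lemma spoke_inj : {in darts_at v &, injective (fun d => node K (ginv K d))}.
Proof.
move=> d d'; rewrite !inE => /eqP dv /eqP d'v dd'; apply/eqP; apply: contraT => ndd'.
case: v_simple; exists d, d'; split=> //; apply/eqP=> E.
by have := no_loop Kcubic Kbridgeless d; rewrite -E dv d'v eqxx.
Qed.

Lemma card_neighbours : #|neighbours| = 3.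
Proof. by rewrite (card_in_imset spoke_inj) (card_darts_at Kcubic vV). Qed.

Lemma neighboursP d : node K d = v -> node K (ginv K d) \in neighbours.
Proof. by move=> dv; apply: imset_f; rewrite inE dv. Qed.

Lemma v_notin_neighbours : v \notin neighbours.
Proof.
apply/imsetP=> -[d]; rewrite inE => dv E.
by have := ginv_away Kcubic Kbridgeless dv; rewrite -E eqxx.
Qed.

Local Notation W := (vertices K :\: (v |: neighbours)).

(** The matching pairs vertices whereas [N] consists of darts, so one of possibly several parallel
    edges is chosen for each pair; the spokes cover [v] and its neighbours. *)
Lemma claw_factor_of_matching M :
  is_matching (@adj K) W M -> unmatched W M = set0 -> exists N, claw_factor v N.
Proof.
move=> /is_matchingP [MK hM] un0.
have [d0 _ _] := imsetP vV.
have Mx x : x \in W -> [/\ M x \in W, M x != x & adj x (M x)].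
  move=> xW; have : x \notin unmatched W M by rewrite un0 inE.
  rewrite inE xW /= => nx; split=> //; case: (hM x) => [E|/and3P []] //;
  by rewrite E eqxx in nx.
pose edge x := odflt d0 [pick d | (node K d == x) && (node K (ginv K d) == M x)].
have edgeP x : x \in W -> node K (edge x) = x /\ node K (ginv K (edge x)) = M x.
  case/Mx=> _ _ /existsP [d hd]; rewrite /edge.
  case: pickP => [d' /andP [/eqP -> /eqP ->] // | /(_ d)].
  by rewrite hd.
(* The rank comparison makes both ends of a matched pair choose the same edge. *)
pose f x := if enum_rank x < enum_rank (M x) then edge x else ginv K (edge (M x)).
have fP x : x \in W -> node K (f x) = x.
  move=> xW; have [MW _ _] := Mx x xW; rewrite /f; case: ifP => _; first by case: (edgeP x xW).
  by have [_ ->] := edgeP _ MW; rewrite MK.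
have fM x : x \in W -> ginv K (f x) = f (M x).
  move=> xW; have [_ nx _] := Mx x xW; rewrite /f MK.
  have : enum_rank x != enum_rank (M x) :> nat.
    by rewrite (inj_eq val_inj) (inj_eq enum_rank_inj) eq_sym.
  by case: ltngtP; rewrite ?(ginvK Kcubic).
pose N := [set d | [|| node K d == v, node K (ginv K d) == v | d \in f @: W]].
have sub d : d \in N -> ginv K d \in N.
  rewrite !inE (ginvK Kcubic) => /or3P [->|->|/imsetP [x xW ->]]; rewrite ?orbT //.
  rewrite fM //; have [MW _ _] := Mx x xW.
  by rewrite [_ \in f @: W]imset_f ?orbT.
exists N; split=> [d|d dv|d dv].
- by apply/idP/idP => [/sub|/sub //]; rewrite (ginvK Kcubic).
- by rewrite inE dv eqxx.
have [dW|dW] := boolP (node K d \in W).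
  exists (f (node K d)); split; first by rewrite inE [_ \in f @: W]imset_f ?orbT.
    exact: fP.
  move=> d' + d'd; rewrite inE d'd (negPf dv) /= => /orP [/eqP d'v|/imsetP [x xW d'x]].
    have := neighboursP d'v; rewrite (ginvK Kcubic) d'd => dN.
    by move: dW; rewrite !inE dN orbT.
  by rewrite d'x -d'd d'x fP.
have : node K d \in neighbours.
  by move: dW; rewrite !inE node_vertex (negPf dv) andbT negbK.
case/imsetP=> s; rewrite inE => /eqP sv sd.
exists (ginv K s); split=> [||d' + d'd]; rewrite ?inE ?(ginvK Kcubic) ?sv ?eqxx ?orbT //.
rewrite d'd (negPf dv) /= => /orP [d'v|/imsetP [x xW d'x]].
  apply: (can_inj (ginvK Kcubic)); rewrite (ginvK Kcubic).
  by apply: spoke_inj; rewrite ?inE ?sv ?eqxx // (ginvK Kcubic) d'd.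
by move: dW; rewrite -d'd d'x fP // xW.
Qed.

Lemma claw_factor_or_barrier :
  (exists N, claw_factor v N) \/
  exists U, [/\ bipartising_set U, v \notin U & forall d, node K d = v -> node K (ginv K d) \in U].
Proof.
have [M [S [MW SW leS]]] := tutte_berge (adj_sym Kcubic) W.
have [un0|un_neq0] := eqVneq (unmatched W M) set0.
  by left; apply: claw_factor_of_matching un0.
right; have vN := v_notin_neighbours.
have NV : v |: neighbours \subset vertices K.
  by rewrite subUset sub1set vV; apply/subsetP=> _ /imsetP [d _ ->]; apply: node_vertex.
have cN : #|v |: neighbours| = 4 by rewrite cardsU1 vN card_neighbours.
(* The cut of the whole vertex set is empty, so [odd_cut] applies. *)
have evenV : ~~ odd #|vertices K|.
  rewrite -(odd_cut Kcubic (subxx _)) (_ : cut _ = set0) ?cards0 //.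
  by apply/setP=> d; rewrite !inE !node_vertex.
(* [W] omits four vertices of an even number, so the number of unmatched vertices is even, and it is
   not zero. *)
have un2 : 2 <= #|unmatched W M|.
  have := odd_unmatched MW; rewrite cardsD (setIidPr NV) cN oddB; last first.
    by rewrite -cN subset_leq_card.
  rewrite (negPf evenV) /=; move: un_neq0; rewrite -card_gt0.
  by case: #|_| => [|[|n]].
pose U := S :|: neighbours; exists U.
have SV : S \subset vertices K by apply: subset_trans SW (subsetDl _ _).
have vS : v \notin S by apply/negP=> /(subsetP SW); rewrite !inE eqxx.
have vU : v \notin U by rewrite inE negb_or vS.
have spokesU d : node K d = v -> node K (ginv K d) \in U.
  by move=> dv; rewrite inE neighboursP ?orbT.
split=> //; have UV : U \subset vertices K.
  by rewrite subUset SV (subset_trans (subsetUr _ _) NV).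
have SN0 : S :&: neighbours = set0.
  apply/setP=> x; rewrite !inE; apply/negP=> /andP [/(subsetP SW)].
  by rewrite !inE => /andP [/norP [_ /negPf ->]].
have cU : #|U| = #|S| + 3 by rewrite cardsU SN0 cards0 subn0 card_neighbours.
have adj_v x : adj v x -> x \in U.
  by case/existsP=> d /andP [/eqP dv /eqP <-]; apply: spokesU.
have in_W x y : adj x y -> x \notin U -> y \notin U -> x \in W :\: S.
  move=> xy xU yU; have [d /andP [/eqP dx _]] := existsP xy.
  have xv : x != v by apply: contraNneq yU => xv; apply: adj_v; rewrite -xv.
  have xV : x \in vertices K by rewrite -dx node_vertex.
  by move: xU; rewrite !inE xV (negPf xv) andbT /= => /norP [-> ->].
(* The vertex [v] is isolated in [K - U], as all its neighbours lie in [U]; so deleting it as well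
   leaves the same adjacency. *)
have eqr : restr (@adj K) (W :\: S) =2 adj_out U.
  move=> x y; rewrite /restr /adj_out; have [xy|] := boolP (adj x y); last by rewrite !andbF.
  have out z : z \in W :\: S -> z \notin U.
    by rewrite !inE => /andP [/negPf -> /andP [/norP [_ /negPf ->]]].
  apply/and3P/and3P => -[xU yU _]; split; rewrite ?out //.
    exact: in_W xy xU yU.
  by apply: in_W yU xU; rewrite (adj_sym Kcubic).
have v_alone y : connect (adj_out U) v y -> y = v.
  case/connectP=> -[|z p] //= /andP [/and3P [_ zU /adj_v]].
  by rewrite (negPf zU).
apply: barrier_bipartising => //; first by rewrite cU addn3.
have sub : v |: odd_roots (@adj K) (W :\: S) \subset odd_components U.
  rewrite subUset sub1set inE in_setD vV vU (v_alone _ (connect_root _ _)) eqxx /=.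
  apply/andP; split.
    rewrite (_ : [set _ | _] = [set v]) ?cards1 //.
    by apply/setP=> y; rewrite !inE; apply/idP/eqP => [/v_alone|->].
  apply/subsetP=> r; rewrite inE => /and3P [rW rr ro]; rewrite inE.
  move: rr ro; rewrite (eq_root eqr) => -> /=.
  under eq_finset do rewrite (eq_connect eqr). move=> ->; rewrite andbT.
  move: rW; rewrite !inE => /andP [/negPf -> /andP [/norP [_ /negPf ->] ->]] //.
(* [U] has |S| + 3 elements. The Tutte-Berge bound supplies |S| + 2 odd components, and {v} is one
   more. *)
apply: leq_trans (subset_leq_card sub).
rewrite cardsU1 inE !inE eqxx /= !andbF cU add1n addnS ltnS.
by apply: leq_trans leS; rewrite addnC leq_add2r.
Qed.

End Claw.

Theorem theorem6p9 (H K : cgraph) (u : vtx H) (v : vtx K)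
  (phi : {d : dart H | node H d == u} -> {e : dart K | node K e == v}) :
  bijective phi ->
  two_connected_cubic H -> two_connected_cubic K ->
  u \in vertices H -> v \in vertices K ->
  proper_3sum u v ->
  5 <= pmi H ->
  colourable3 K ->
  apex u ->
  5 <= pmi (sum3 phi) ->
  quasi_bipartite K /\
  exists U : {set vtx K},
    [/\ bipartising_set U, v \notin U &
        forall y, connect (adj_out U) v y -> y = v].
Proof.
move=> phi_bij Htc Ktc uV vV [_ _ _ v_simple] _ Kcol [_ _ _ pmi4] pmi5.
have [Hcubic _ Hbridgeless] := Htc; have [Kcubic _ Kbridgeless] := Ktc.
suff [U [UB vU vN]] : exists U, [/\ bipartising_set U, v \notin U &
    forall d, node K d = v -> node K (ginv K d) \in U].
  split; [by exists U | exists U; split=> // y].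
  case/connectP=> -[|z p] //= /andP [/and3P [_ zU /existsP [d /andP [/eqP /vN dU /eqP dz]]]].
  by rewrite -dz dU in zU.
have [[N Nclaw]|//] := claw_factor_or_barrier Kcubic Kbridgeless vV v_simple.
have cov : pm_coverable (inflate u) 4.
  (* At least four darts are needed: the three at [u], and the opposite dart of one of them, which
     lies elsewhere because [H] has no loop. *)
  rewrite -pmi4; apply: coverable_pmi; rewrite pmi4 card_sum.
  have [d _ dE] := imsetP uV; have du : node H d == u by rewrite dE.
  apply: leq_trans (leq_addr _ _); rewrite -(card_darts_at Hcubic uV) -cardsT.
  apply: proper_card; apply/properP; split; first exact: subsetT.
  by exists (ginv H d); rewrite ?inE // ginv_away.
by move: pmi5; rewrite ltnNge pmi_le_of_coverable ?(sum3_coverable phi_bij Htc Ktc uV vV Nclaw).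
Qed.
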